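(* Let $\mathcal{D}$ be the set of all Condorcet domains in $W$ and $\mathcal{P}$ the set of all Condorcet root posets on $\Phi$. The assignments $D\mapsto\varphi(D)$ and $P\mapsto\psi(P)$ (defined in the context) give well-defined maps $\varphi:\mathcal{D}\to\mathcal{P}$ and $\psi:\mathcal{P}\to\mathcal{D}$; moreover $\varphi(\mathcal{D})=\mathcal{P}$, and $\varphi$ and $\psi$ provide a pair of mutually inverse bijections between $\psi(\mathcal{P})\subseteq\mathcal{D}$ and $\varphi(\mathcal{D})=\mathcal{P}$.
   Context: Let $\Phi$ be a finite root system in a real Euclidean space (a finite set of nonzero vectors with $\Phi\cap\mathbb{R}\alpha=\{\alpha,-\alpha\}$ and $s_\alpha(\Phi)=\Phi$ for all $\alpha\in\Phi$, where $s_\alpha$ is the orthogonal reflection in $\alpha^\perp$; not necessarily crystallographic). Let $\Phi^+$ be a choice of positive roots, $\Phi^-=\Phi\setminus\Phi^+$, and let $W=W(\Phi)$ be the finite Coxeter group generated by the $s_\alpha$. For $w\in W$, the (left) inversion set is $I(w):=\{\alpha\in\Phi\mid w^{-1}\alpha\in\Phi^-\}$ (negative roots are allowed, so exactly one of $\alpha,-\alpha$ lies in $I(w)$). A set of three roots $\{\alpha,\beta,\gamma\}\subseteq\Phi$ is a root-triple if there exist real $a,b,c>0$ with $a\alpha+b\beta+c\gamma=0$. A nonempty subset $D\subseteq W$ is a Condorcet domain if there do not exist distinct $u,v,w\in D$ and a root-triple $\{\alpha,\beta,\gamma\}$ such that $\alpha,\beta\in I(u)$, $\alpha,\gamma\in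 I(v)$, $\beta,\gamma\in I(w)$. ''Poset'' means preposet: a reflexive transitive relation $\le$, not necessarily antisymmetric; $x=y$ in $P$ means $x\le y$ and $y\le x$; $x<y$ means $x\le y$ and not $y\le x$. A preposet $P$ on the set $\Phi$ is an antipodal root poset if (1) for all $\alpha,\beta\in\Phi$, $\alpha\le\beta$ implies $-\beta\le-\alpha$; (2) for all $\gamma\in\Phi$, $\gamma\neq-\gamma$ in $P$, and if $\gamma<-\gamma$ then $\gamma$ is a minimum element of $P$ (i.e. $\gamma\le\delta$ for all $\delta$; there may be several minimum elements, all equal in $P$). It is a Condorcet root poset if moreover (3) for every root-triple there is a labelling $\{\alpha,\beta,\gamma\}$ of its elements such that in $P$ either $\alpha\ge-\gamma\ge\beta$ or $\alpha=-\gamma$. An order ideal is a down-closed subset. A symmetric order ideal of $P$ is an order ideal $I$ with $I\sqcup -I=\Phi$ (disjoint union), where $-I=\{-\alpha\mid\alpha\in I\}$; $J_s(P)$ is the set of symmetric order ideals. For nonempty $D\subseteq W$ and $\gamma\in\Phi$ let $D(\gamma)=\{v\in D\mid\gamma\in I(v)\}$; $\varphi(D)$ is the preposet on $\Phi$ with $\alpha\le\beta$ if and only if $D(\alpha)\supseteq D(\beta)$. For an antipodal root poset $P$, $\psi(P)=\{w\in W\mid I(w)\in J_s(P)\}$. *)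

(* Defs.v *)
From HB Require Import structures.
From mathcomp Require Import all_boot all_order all_algebra sesquilinear.
From mathcomp Require Import boolp classical_sets functions cardinality reals.
Set Implicit Arguments.
Unset Strict Implicit.
Unset Printing Implicit Defensive.
Import Order.TTheory GRing.Theory Num.Theory.
Local Open Scope classical_set_scope.
Local Open Scope ring_scope.

Section Reflection.
Variables (R : realType) (V : vectType R) (dot : {dot V for idfun}) (a : V).

Definition reflection (v : V) : V := v - (2 * dot v a / dot a a) *: a.

Lemma reflection_is_linear : linear reflection.
Proof.
move=> k u v; rewrite /reflection linearPl /= scalerBr scalerA addrACA -opprD.
by rewrite -scalerDl mulrDr mulrDl !mulrA (mulrC k 2).
Qed.

HB.instance Definition _ :=
  GRing.isLinear.Build R V V *:%R reflection reflection_is_linear.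

End Reflection.

Section RootSystem.
Variables (R : realType) (V : vectType R) (dot : {dot V for idfun}).
Implicit Types (Phi Pos : set V) (w : 'End(V)) (D : set 'End(V)).

Definition root_system Phi : Prop :=
  [/\ finite_set Phi,
      forall a, Phi a -> a != 0,
      forall a, Phi a -> Phi `&` [set c *: a | c in [set: R]] = [set a; - a] &
      forall a, Phi a -> reflection dot a @` Phi = Phi].

(* The roots on one side of a hyperplane that contains no root. *)
Definition positive_roots Phi Pos : Prop :=
  exists t : V, (forall a, Phi a -> dot t a != 0) /\
    Pos = [set a | Phi a /\ 0 < dot t a].

(* Reflections are involutions, so the group they generate consists of the
   finite products of them.  [linfun] bundles a linear map as an element of
   ['End(V)], where [w^-1] is the inverse map for invertible [w]. *)
Definition coxeter_group Phi : set 'End(V) :=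
  [set w | exists s : seq V, (forall a, a \in s -> Phi a) /\
     w = foldr (fun a f => linfun (reflection dot a) \o f)%VF \1%VF s].

Definition inversion_set Phi Pos w : set V :=
  [set a | Phi a /\ (Phi `\` Pos) ((w^-1)%VF a)].

Definition root_triple Phi (a b c : V) : Prop :=
  [/\ Phi a, Phi b & Phi c] /\ [/\ a <> b, b <> c & a <> c] /\
  exists x y z : R, [/\ 0 < x, 0 < y & 0 < z] /\
    x *: a + y *: b + z *: c = 0.

Definition condorcet_domain Phi Pos D : Prop :=
  [/\ D `<=` coxeter_group Phi, D !=set0 &
   ~ exists u v w a b c,
      [/\ D u, D v & D w] /\ [/\ u <> v, v <> w & u <> w] /\
      root_triple Phi a b c /\
      [/\ inversion_set Phi Pos u a /\ inversion_set Phi Pos u b,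
          inversion_set Phi Pos v a /\ inversion_set Phi Pos v c &
          inversion_set Phi Pos w b /\ inversion_set Phi Pos w c]].

End RootSystem.

(* A preposet on [Phi] is a relation on the ambient space [V] that is supported
   on [Phi], so that equality of relations is equality of preposets on [Phi]. *)
Section RootPoset.
Variables (R : realType) (V : vectType R).
Implicit Types (Phi Pos I : set V) (P : V -> V -> Prop).

Definition preposet_on Phi P : Prop :=
  [/\ forall a b, P a b -> Phi a /\ Phi b,
      forall a, Phi a -> P a a &
      forall a b c, P a b -> P b c -> P a c].

Definition preposet_eq P a b : Prop := P a b /\ P b a.

Definition preposet_lt P a b : Prop := P a b /\ ~ P b a.

Definition antipodal_root_poset Phi P : Prop :=
  [/\ preposet_on Phi P,
      forall a b, Phi a -> Phi b -> P a b -> P (- b) (- a),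
      forall g, Phi g -> ~ preposet_eq P g (- g) &
      forall g, Phi g -> preposet_lt P g (- g) -> forall d, Phi d -> P g d].

Definition condorcet_root_poset Phi P : Prop :=
  antipodal_root_poset Phi P /\
  forall a0 b0 c0, root_triple Phi a0 b0 c0 ->
    exists a b c, [set a; b; c] = [set a0; b0; c0] /\
      ((P (- c) a /\ P b (- c)) \/ preposet_eq P a (- c)).

Definition order_ideal Phi P I : Prop :=
  I `<=` Phi /\ forall a b, I b -> P a b -> I a.

Definition symmetric_order_ideal Phi P I : Prop :=
  [/\ order_ideal Phi P I,
      I `&` [set - a | a in I] = set0 &
      I `|` [set - a | a in I] = Phi].

End RootPoset.

Section Maps.
Variables (R : realType) (V : vectType R) (dot : {dot V for idfun}).
Variables (Phi Pos : set V).

Definition domain_at (D : set 'End(V)) (g : V) : set 'End(V) :=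
  [set v | D v /\ inversion_set Phi Pos v g].

Definition phi (D : set 'End(V)) : V -> V -> Prop :=
  fun a b => [/\ Phi a, Phi b & domain_at D b `<=` domain_at D a].

Definition psi (P : V -> V -> Prop) : set 'End(V) :=
  [set w | coxeter_group dot Phi w /\
           symmetric_order_ideal Phi P (inversion_set Phi Pos w)].

End Maps.

(* Main.v *)
Require Import Defs.
From mathcomp Require Import all_boot all_order all_algebra sesquilinear.
From mathcomp Require Import boolp classical_sets functions cardinality reals.
Set Implicit Arguments.
Unset Strict Implicit.
Unset Printing Implicit Defensive.
Import Order.TTheory GRing.Theory Num.Theory.
Local Open Scope classical_set_scope.
Local Open Scope ring_scope.

(** The proof rests on a dictionary between subsets of W and families of
    half-systems, that is, sets of roots containing exactly one of [a], [- a]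
    for each root [a].

    From domains to posets.  No inversion set contains all, or none, of a
    root-triple, because positive roots lie in an open half-space.  Hence the
    Condorcet condition says that some two members of a triple never occur
    together in [inversion_set Phi Pos u], [u] in [D].  Applied to the negated
    triple, it also gives two members that are never both absent.  When the two
    pairs coincide, this is an equality [a = - c] in [phi D]; when they share
    one root [c], it is a chain [b <= - c <= a] (lemma [phi_condorcet]).

    From posets to domains.  Axiom (3) forbids a symmetric order ideal to
    contain a fixed pair of each root-triple, the pair not depending on the
    ideal.  As any two of the three pairs in the Condorcet condition exhaust
    the triple, this makes [psi P] satisfy that condition.

    Inverse maps.  Two existence statements are needed.
    - Every half-system without root-triples is the inversion set of an element
      of W ([half_system_inversion_set]).  Reflecting in any positive root of
      the half-system strictly decreases its number of positive roots, so that
      finitely many reflections reach the set of negative roots.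
    - If [a <= b] fails in an antipodal root poset, some symmetric order ideal
      contains [b] but not [a] ([separating_symmetric_ideal]): axiom (2) is
      exactly what makes the order ideal generated by [b] and [- a] disjoint
      from its opposite, and such an ideal always extends to a symmetric one.
    Together they show that [psi P] is nonempty and that [phi (psi P) = P]; the
    remaining claims are formal. *)

(** * Symmetric order ideals of antipodal root posets *)

Definition half_system {R : realType} {V : vectType R} (Phi I : set V) : Prop :=
  I `<=` Phi /\ forall a, Phi a -> (I (- a) <-> ~ I a).

Section SymmetricIdeals.
Context {R : realType} {V : vectType R} {Phi : set V}.
Hypothesis Phi_fin : finite_set Phi.
Hypothesis Phi_opp : forall a, Phi a -> Phi (- a).

Lemma symmetric_order_idealP (P : V -> V -> Prop) (I : set V) :
  symmetric_order_ideal Phi P I <-> order_ideal Phi P I /\ half_system Phi I.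
Proof.
have oppI a : [set - x | x in I] a <-> I (- a).
  by split=> [[x Ix <-]|Ia]; [rewrite opprK | exists (- a); rewrite ?opprK].
split=> [[idI disj cov]|[idI [IPhi IN]]].
  split=> //; split=> [|a Pa]; first by case: idI.
  split=> [INa Ia|nIa].
    have : (I `&` [set - x | x in I]) a by split=> //; apply/oppI.
    by rewrite disj.
  have : (I `|` [set - x | x in I]) a by rewrite cov.
  by case=> // /oppI.
split=> //; apply/seteqP; split=> a //.
- by case=> Ia /oppI /(IN _ (IPhi _ Ia)).
- by case=> [/IPhi|/oppI/IPhi/Phi_opp] //; rewrite opprK.
- move=> Pa; case: (pselect (I a)) => [|nIa]; first by left.
  by right; apply/oppI/(IN _ Pa).
Qed.

Section Antipodal.
Context {P : V -> V -> Prop}.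
Hypothesis P_antipodal : antipodal_root_poset Phi P.

Let P_root a b : P a b -> Phi a /\ Phi b.
Proof. by case: P_antipodal => -[? _ _] _ _ _; auto. Qed.

Let P_refl a : Phi a -> P a a.
Proof. by case: P_antipodal => -[_ ? _] _ _ _; auto. Qed.

Let P_trans b a c : P a b -> P b c -> P a c.
Proof. by case: P_antipodal => -[_ _ trP] _ _ _; apply: trP. Qed.

Let P_opp a b : P a b -> P (- b) (- a).
Proof.
by move=> Pab; have [Pa Pb] := P_root Pab; case: P_antipodal => _ H _ _; auto.
Qed.

Let P_neq g : Phi g -> P g (- g) -> P (- g) g -> False.
Proof. by case: P_antipodal => _ _ H _ Pg ? ?; apply: (H g). Qed.

Let P_min g d : Phi g -> Phi d -> P g (- g) -> P g d.
Proof.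
move=> Pg Pd lt_g; case: P_antipodal => _ _ _ H; apply: H => //; split=> //.
exact: P_neq.
Qed.

(** The undecided pairs [g], [- g] are settled one at a time.  As [g] and [- g]
    differ in [P], one of them, say [g], does not lie above its opposite; then
    the order ideal below [g] can be added, since a clash between [J] and that
    ideal would put [- g] in [J]. *)
Lemma isotropic_ideal_extension (J : set V) :
    order_ideal Phi P J -> (forall a, J a -> ~ J (- a)) ->
  exists2 I, J `<=` I & symmetric_order_ideal Phi P I.
Proof.
move=> idJ isoJ; have /finite_seqP [s Phi_s] := Phi_fin.
have add_ideal K g : order_ideal Phi P K -> (forall a, K a -> ~ K (- a)) ->
    Phi g -> ~ K (- g) -> ~ P (- g) g ->
    order_ideal Phi P (K `|` P^~ g) /\
    (forall a, (K `|` P^~ g) a -> ~ (K `|` P^~ g) (- a)).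
  move=> [KPhi Kdown] isoK Pg nKg nPg; split.
    split=> [a [/KPhi //|/P_root[] //]|a b [Kb|Pbg] Pab].
      by left; apply: Kdown Pab.
    by right; apply: P_trans Pbg.
  move=> a [Ka|Pag] [Ka'|Pag'].
  - exact: isoK Ka'.
  - by apply: nKg; apply: (Kdown _ a) => //; rewrite -[a]opprK; apply: P_opp.
  - by apply: nKg; apply: (Kdown _ (- a)) => //; apply: P_opp.
  - have := P_opp Pag'; rewrite opprK => /P_trans PNg.
    by apply: nPg; apply: PNg.
have decide (s' : seq V) : {subset s' <= s} -> exists I,
    [/\ J `<=` I, order_ideal Phi P I,
    forall a, I a -> ~ I (- a) & forall a, a \in s' -> I a \/ I (- a)].
  elim: s' => [_|g s' IHs sub]; first by exists J; split=> // x.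
  have sub' : {subset s' <= s} by move=> x xs'; apply: sub; rewrite inE xs' orbT.
  have [K [JK idK isoK decK]] := IHs sub'.
  have Pg : Phi g by rewrite Phi_s /=; apply: sub; rewrite inE eqxx.
  case: (pselect (K g \/ K (- g))) => [Kg|nKg].
    by exists K; split=> // a; rewrite inE => /orP[/eqP->|/decK].
  have [nKg1 nKg2] : ~ K g /\ ~ K (- g) by tauto.
  case: (pselect (P (- g) g)) => [PNg|nPg].
    have nPg' : ~ P (- - g) (- g).
      by rewrite opprK => Pg'; apply: P_neq PNg.
    have [] := add_ideal _ _ idK isoK (Phi_opp Pg) _ nPg'.
      by rewrite opprK.
    move=> idK' isoK'; exists (K `|` P^~ (- g)); split=> //.
      by move=> x /JK; left.
    move=> a; rewrite inE => /orP[/eqP->|/decK[]]; try by [left; left|right; left].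
    by right; right; apply/P_refl/Phi_opp.
  have [idK' isoK'] := add_ideal _ _ idK isoK Pg nKg2 nPg.
  exists (K `|` P^~ g); split=> //.
    by move=> x /JK; left.
  move=> a; rewrite inE => /orP[/eqP->|/decK[]]; try by [left; left|right; left].
  by left; right; apply/P_refl.
have [I [JI idI isoI decI]] := decide s (fun _ xs => xs).
exists I => //; apply/symmetric_order_idealP; split=> //; split=> [|a Pa].
  by case: idI.
split=> [INa Ia|nIa]; first exact: (isoI a).
by have [] := decI a; rewrite Phi_s in Pa.
Qed.

(** If the order ideal generated by [b] and [- a] met its opposite, then [P]
    would contain [- b <= b], [a <= - a] or [a <= b]; by axiom (2) the first two
    make [- b], respectively [a], a minimum, so each of the three gives
    [a <= b]. *)
Lemma separating_symmetric_ideal a b : Phi a -> Phi b -> ~ P a b ->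
  exists I, [/\ symmetric_order_ideal Phi P I, I b & ~ I a].
Proof.
move=> Pa Pb nPab; pose J := P^~ b `|` P^~ (- a).
have nPb : ~ P (- b) b.
  move=> PNb; apply: nPab; rewrite -[a]opprK -[b]opprK; apply: P_opp.
  by apply: P_min; rewrite ?opprK; auto.
have nPa : ~ P a (- a) by move=> PaN; apply/nPab/P_min.
have [||I JI symI] := isotropic_ideal_extension (J := J).
- split=> [x [/P_root[]|/P_root[]] //|x y Jy Pxy].
  by case: Jy => Py; [left|right]; apply: P_trans Py.
- move=> x [x1|x1] [x2|x2]; have := P_opp x2; rewrite !opprK => x3.
  + by apply: nPb; apply: P_trans x1.
  + by apply: nPab; apply: P_trans x1.
  + by apply: nPab; rewrite -[a]opprK -[b]opprK; apply: P_opp; apply: P_trans x1.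
  + by apply: nPa; apply: P_trans x1.
exists I; split=> //; first by apply: JI; left; apply: P_refl.
have [_ [_ IN]] := (symmetric_order_idealP _ _).1 symI.
by apply/(IN _ Pa); apply: JI; right; apply/P_refl/Phi_opp.
Qed.

End Antipodal.

(** In both alternatives of axiom (3) one has [- c <= a], so an ideal that
    contains [a] also contains [- c], hence not [c]. *)
Lemma condorcet_triple_incompatible (P : V -> V -> Prop) a0 b0 c0 :
    condorcet_root_poset Phi P -> root_triple Phi a0 b0 c0 ->
  let never x y := forall I, symmetric_order_ideal Phi P I -> ~ (I x /\ I y) in
  [\/ never a0 b0, never a0 c0 | never b0 c0].
Proof.
move=> [P_anti P_triple] tri never.
have neverC x y : never x y -> never y x by move=> H I /H; tauto.
have [[Pa Pb Pc] [[neab nebc neac] _]] := tri.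
have [a [b [c [abcE rel]]]] := P_triple _ _ _ tri.
have never_ac : Phi c -> never a c.
  move=> Phic I /symmetric_order_idealP [[_ Idown] [_ IN]] [Ia Ic].
  have PNca : P (- c) a by case: rel => -[].
  exact: (IN _ Phic).1 (Idown _ _ Ia PNca) Ic.
have aE : [set a0; b0; c0] a by rewrite -abcE /=; tauto.
have cE : [set a0; b0; c0] c by rewrite -abcE /=; tauto.
have Phic : Phi c by case: cE => [[]|] ->.
move: never_ac => /(_ Phic) nac.
(* The labelling of axiom (3) uses all three roots, so it cannot repeat one. *)
have neac' : a <> c.
  move=> eac; subst c.
  have inE' x : [set a0; b0; c0] x -> x = a \/ x = b.
    by rewrite -abcE /=; tauto.
  have [a1|a1] := inE' a0 (or_introl (or_introl erefl));
  have [b1|b1] := inE' b0 (or_introl (or_intror erefl));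
  have [c1|c1] := inE' c0 (or_intror erefl); congruence.
move: nac neac'; case: aE => [[]|] ->; case: cE => [[]|] -> nac neac' //.
- exact: Or31.
- exact: Or32.
- by apply: Or31; apply: neverC.
- exact: Or33.
- by apply: Or32; apply: neverC.
- by apply: Or33; apply: neverC.
Qed.

End SymmetricIdeals.

(** * Inversion sets of the elements of a finite reflection group *)

Section InversionSets.
Context {R : realType} {V : vectType R} {dot : {dot V for idfun}} {Phi : set V}.
Hypothesis Phi_root : root_system dot Phi.

Lemma root_system_finite : finite_set Phi.
Proof. by case: Phi_root. Qed.

Lemma root_opp a : Phi a -> Phi (- a).
Proof.
move=> Pa; case: Phi_root => _ _ /(_ _ Pa) line _.
by have [] : (Phi `&` [set c *: a | c in [set: R]]) (- a) by rewrite line; right.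
Qed.

Lemma root_scale a k : Phi a -> Phi (k *: a) -> k *: a = a \/ k *: a = - a.
Proof.
move=> Pa Pka; case: Phi_root => _ _ /(_ _ Pa) line _.
suff : [set a; - a] (k *: a) by [].
by rewrite -line; split=> //; exists k.
Qed.

Lemma reflection_root a b : Phi a -> Phi b -> Phi (reflection dot a b).
Proof.
by move=> Pa Pb; case: Phi_root => _ _ _ /(_ _ Pa) <-; exists b.
Qed.

Lemma reflection_self a : Phi a -> reflection dot a a = - a.
Proof.
move=> Pa; have a0 : a != 0 by case: Phi_root => _ /(_ _ Pa).
have da : dot a a != 0 by apply: lt0r_neq0; apply: neq0_dnorm_gt0.
by rewrite /reflection mulfK // scaler_nat mulr2n opprD addrA subrr sub0r.
Qed.

Lemma reflectionK a : Phi a -> involutive (reflection dot a).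
Proof.
move=> Pa v; rewrite {2}/reflection linearB linearZ /= reflection_self //.
by rewrite /reflection scalerN opprK subrK.
Qed.

Lemma root_triple_opp a b c : root_triple Phi a b c ->
  root_triple Phi (- a) (- b) (- c).
Proof.
move=> [[Pa Pb Pc] [[nab nbc nac] [x [y [z [pos e]]]]]].
split; first by split; apply: root_opp.
split; first by split=> /oppr_inj.
exists x, y, z; split=> //.
by rewrite !scalerN -!opprD e oppr0.
Qed.

Lemma root_triple_reflection s a b c : Phi s -> root_triple Phi a b c ->
  root_triple Phi (reflection dot s a) (reflection dot s b) (reflection dot s c).
Proof.
move=> Ps [[Pa Pb Pc] [[nab nbc nac] [x [y [z [pos e]]]]]].
split; first by split; apply: reflection_root.
split; first by split=> /(inv_inj (reflectionK Ps)).
exists x, y, z; split=> //.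
by rewrite -!linearZ -!linearD e linear0.
Qed.

Lemma coxeter_group_root w : coxeter_group dot Phi w ->
  lker w == 0%VS /\ forall v, Phi (w v) <-> Phi v.
Proof.
case=> s [sPhi ->]; elim: s sPhi => [_|a s IHs sPhi] /=.
  by split=> [|v]; rewrite ?id_lfunE //; apply/lker0P => x y; rewrite !id_lfunE.
have Pa : Phi a by apply: sPhi; rewrite inE eqxx.
have [|/lker0P injw rootw] := IHs.
  by move=> x xs; apply: sPhi; rewrite inE xs orbT.
split=> [|v].
  apply/lker0P => x y; rewrite !comp_lfunE !lfunE /=.
  by move=> /(inv_inj (reflectionK Pa)) /injw.
rewrite comp_lfunE lfunE /=; split=> [|/rootw /(reflection_root Pa)] //.
by move/(reflection_root Pa); rewrite reflectionK // => /rootw.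
Qed.

Lemma coxeter_group_inv_root w a : coxeter_group dot Phi w -> Phi a ->
  Phi ((w^-1)%VF a).
Proof.
by move=> /coxeter_group_root[kerw rootw] Pa; apply/rootw; rewrite lker0_lfunVK.
Qed.

Context {t : V}.
Hypothesis t_regular : forall a, Phi a -> dot t a != 0.
Local Notation Pos := [set a | Phi a /\ 0 < dot t a].

Lemma nonpositive_root a : Phi a -> (~ Pos a <-> dot t a < 0).
Proof.
move=> Pa; have := t_regular Pa; case: ltgtP => // h _; split=> //.
- by move=> _ [_]; rewrite ltNge ltW.
- by case.
Qed.

Lemma positive_root_opp a : Phi a -> (Pos (- a) <-> ~ Pos a).
Proof.
move=> Pa; rewrite nonpositive_root //= linearNr oppr_gt0.
by split=> [[]|] //; split=> //; apply: root_opp.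
Qed.

Lemma positive_triple_free a b c : root_triple Phi a b c ->
  ~ [/\ Pos a, Pos b & Pos c].
Proof.
move=> [_ [_ [x [y [z [[x0 y0 z0] e]]]]]] [[_ a0] [_ b0] [_ c0]].
have : dot t (x *: a + y *: b + z *: c) = 0 by rewrite e linear0r.
rewrite !linearDr !linearZr_LR /= => /eqP; apply/negP/lt0r_neq0.
by rewrite !addr_gt0 ?mulr_gt0.
Qed.

Lemma inversion_set_half_system w : coxeter_group dot Phi w ->
  half_system Phi (inversion_set Phi Pos w).
Proof.
move=> Ww; split=> [a []|a Pa] //.
have Pwa := coxeter_group_inv_root Ww Pa.
have invN : (w^-1)%VF (- a) = - (w^-1)%VF a by rewrite linearN.
have := positive_root_opp Pwa; have := root_opp Pwa; have := root_opp Pa.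
by rewrite /inversion_set /setD /= invN; tauto.
Qed.

Lemma inversion_set_triple_free w a b c : coxeter_group dot Phi w ->
  root_triple Phi a b c -> let I := inversion_set Phi Pos w in
  ~ [/\ I a, I b & I c].
Proof.
move=> Ww tri I [[Pa [Pwa na]] [Pb [Pwb nb]] [Pc [Pwc nc]]].
have [kerw _] := coxeter_group_root Ww.
apply: (@positive_triple_free (- (w^-1)%VF a) (- (w^-1)%VF b) (- (w^-1)%VF c)).
  apply: root_triple_opp; case: tri => _ [[nab nbc nac] [x [y [z [pos e]]]]].
  have injw : injective (w^-1)%VF := can_inj (lker0_lfunVK kerw).
  split; first by split.
  split; first by split=> /injw.
  exists x, y, z; split=> //.
  by rewrite -!linearZ -!linearD e linear0.
by split; apply/positive_root_opp.
Qed.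

(** For a positive root [d] with negative image [d' = reflection dot s d], the
    positive roots [d] and [- d'] add up to a positive multiple of [s].  As [s]
    is in [I], triple freeness forbids [- d] and [d'] to lie both in [I]; so
    [d] is in [I] as soon as [d'] is.  Consequently the positive roots of the
    reflected set inject into those of [I]: send [d] to [d'] if [d'] is
    positive, and to itself otherwise.  The root [s] is not in the image. *)
Lemma reflection_decreases_positive (I : set V) (r : seq V) s :
    uniq r -> (forall a, a \in r <-> Phi a) -> half_system Phi I ->
    (forall a b c, root_triple Phi a b c -> ~ [/\ I a, I b & I c]) ->
    I s -> Pos s ->
  (count (fun d => `[< I (reflection dot s d) /\ Pos d >]) r <
   count (fun d => `[< I d /\ Pos d >]) r)%N.
Proof.
move=> uniq_r rE [IPhi IN] I_free Is Poss; have Ps : Phi s by case: Poss.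
pose sg := reflection dot s.
have sgK : involutive sg := reflectionK Ps.
have IdN d : Pos d -> I (sg d) -> ~ Pos (sg d) -> I d.
  move=> [Pd td] Isd nPsd; apply: contrapT => nId.
  have Psd : Phi (sg d) := IPhi _ Isd.
  have tsd : dot t (sg d) < 0 by apply/nonpositive_root.
  have nPNd : ~ Pos (- d) by move=> /(positive_root_opp Pd); apply.
  pose k := 2 * dot d s / dot s s.
  have sgE : sg d = d - k *: s by [].
  have k_gt0 : 0 < k.
    have : 0 < k * dot t s.
      have -> : k * dot t s = dot t d - dot t (sg d).
        by rewrite sgE linearBr linearZr_LR /= opprB addrCA subrr addr0.
      by rewrite subr_gt0 (lt_trans tsd).
    by rewrite pmulr_lgt0 //; case: Poss.
  apply: (I_free s (sg d) (- d)); last first.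
    by split=> //; apply/(IN _ Pd).
  split; first by split=> //; apply: root_opp.
  split; last first.
    exists k, 1, 1; split=> //.
    by rewrite !scale1r sgE addrCA subrr addr0 subrr.
  split=> [e|e|e]; [by rewrite -e in nPsd| |by rewrite -e in nPNd].
  (* If [sg d = - d], then [d] is proportional to [s], hence equal to [s] or
     [- s]; but [d] is positive and outside [I]. *)
  have dE : d = (k / 2) *: s.
    have : 2 *: d = k *: s.
      by rewrite scaler_nat mulr2n -[X in _ + X]opprK -e sgE opprB addrCA subrr addr0.
    move/(congr1 (fun v => 2^-1 *: v)); rewrite !scalerA mulVf ?pnatr_eq0 //.
    by rewrite scale1r mulrC.
  rewrite dE in Pd nId nPNd; have [h|h] := root_scale Ps Pd.
    by rewrite h in nId.
  by rewrite h opprK in nPNd.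
pose f d := if `[< Pos (sg d) >] then sg d else d.
rewrite -!size_filter.
set A := filter _ r; set B := filter _ r.
have AE d : d \in A -> I (sg d) /\ Pos d.
  by rewrite mem_filter => /andP[/asboolP].
have BE d : d \in B <-> I d /\ Pos d.
  rewrite mem_filter; split=> [/andP[/asboolP]|[Id Pd]] //.
  by apply/andP; split; [apply/asboolP|apply/rE; case: Pd].
have sB : s \in B by apply/BE.
have inj_f : {in A &, injective f}.
  move=> x y /AE[_ Px] /AE[_ Py]; rewrite /f.
  case: asboolP => hx; case: asboolP => hy //.
  - exact: inv_inj.
  - by move=> e; rewrite -e sgK in hy.
  - by move=> e; rewrite e sgK in hx.
have fA : {subset map f A <= rem s B}.
  move=> _ /mapP[d dA ->]; have [Isd Pd] := AE _ dA.
  rewrite mem_rem_uniq ?filter_uniq // inE; apply/andP.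
  rewrite /f; case: asboolP => h; split; try (by apply/BE; auto); apply/eqP => e.
    have : d = - s by rewrite -[d]sgK e; apply: reflection_self.
    by move=> dE; move: Pd; rewrite dE => /(positive_root_opp Ps); apply.
  move: Isd; rewrite e /sg reflection_self // => /(IN _ Ps); exact.
have := uniq_leq_size _ fA; rewrite map_inj_in_uniq // filter_uniq // => /(_ isT).
rewrite size_map size_rem // => /leq_ltn_trans; apply.
by rewrite prednK //; case: (B) sB.
Qed.

(** Descent on the number of positive roots of [I]; when there are none, [I]
    is the set of negative roots, the inversion set of the identity. *)
Lemma half_system_inversion_set (I : set V) :
    half_system Phi I ->
    (forall a b c, root_triple Phi a b c -> ~ [/\ I a, I b & I c]) ->
  exists2 w, coxeter_group dot Phi w & inversion_set Phi Pos w = I.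
Proof.
have [r uniq_r rE] : exists2 r : seq V, uniq r & forall a, a \in r <-> Phi a.
  case: Phi_root => /finite_seqP[r ->] _ _ _.
  by exists (undup r) => [|a]; rewrite ?undup_uniq ?mem_undup.
move: {2}(count _ r).+1 (ltnSn (count (fun d => `[< I d /\ Pos d >]) r)) => n.
elim: n I => // n IHn I lt_n halfI I_free.
case: (pselect (exists s, I s /\ Pos s)) => [[s [Is Poss]]|noPos]; last first.
  have W1 : coxeter_group dot Phi \1%VF by exists [::].
  exists \1%VF => //; have [IPhi IN] := halfI.
  have inv1 a : ((\1 : 'End(V))^-1)%VF a = a.
    have [ker1 _] := coxeter_group_root W1.
    by rewrite -[LHS]id_lfunE lker0_lfunVK.
  apply/seteqP; split=> a.
    move=> [Pa [_]]; rewrite inv1 => nPa; apply: contrapT => nIa; apply: noPos.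
    by exists (- a); split; [apply/(IN _ Pa)|apply/positive_root_opp].
  move=> Ia; have Pa := IPhi _ Ia; split=> //; rewrite /setD /= inv1; split=> //.
  by move=> Posa; apply: noPos; exists a.
have Ps : Phi s by case: Poss.
pose J := [set d | I (reflection dot s d)].
have [IPhi IN] := halfI.
have [] := IHn J.
- rewrite ltnS in lt_n; apply: leq_trans lt_n.
  exact: (reflection_decreases_positive uniq_r rE halfI I_free Is Poss).
- split=> [d /IPhi /(reflection_root Ps)|d Pd]; first by rewrite reflectionK.
  by rewrite /J /= linearN /=; apply: IN; apply: reflection_root.
- by move=> a b c /(root_triple_reflection Ps) /I_free.
move=> w Ww wJ.
have Wsw : coxeter_group dot Phi (linfun (reflection dot s) \o w)%VF.
  case: Ww => l [lPhi ->]; exists (s :: l); split=> // a.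
  by rewrite inE => /orP[/eqP->|/lPhi].
exists (linfun (reflection dot s) \o w)%VF => //.
have [kw _] := coxeter_group_root Ww; have [ksw _] := coxeter_group_root Wsw.
have invE a : ((linfun (reflection dot s) \o w)^-1)%VF a =
    (w^-1)%VF (reflection dot s a).
  apply: (lker0P ksw); rewrite lker0_lfunVK // comp_lfunE lker0_lfunVK //.
  by rewrite lfunE /= reflectionK.
have IE a : I a <-> J (reflection dot s a) by rewrite /J /= reflectionK.
apply/seteqP; split=> a.
  move=> [Pa h]; apply/IE; rewrite -wJ; split; first exact: reflection_root.
  by rewrite -invE.
by move=> Ia; split; [exact: IPhi|move/IE: Ia; rewrite -wJ => -[_]; rewrite invE].
Qed.

(** * The maps between domains and posets *)

Lemma phi_antipodal D : D `<=` coxeter_group dot Phi -> D !=set0 ->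
  antipodal_root_poset Phi (phi Phi Pos D).
Proof.
move=> DW D0.
have DN a : Phi a -> forall v, D v ->
    (inversion_set Phi Pos v (- a) <-> ~ inversion_set Phi Pos v a).
  by move=> Pa v /DW /inversion_set_half_system [_]; apply.
split.
- split=> [a b []|a Pa|a b c [Pa Pb ab] [_ Pc bc]] //.
    by split=> // v.
  by split=> // v /bc /ab.
- move=> a b Pa Pb [_ _ ab]; split; try exact: root_opp.
  move=> v [Dv /(DN _ Pa _ Dv) na]; split=> //; apply/(DN _ Pb _ Dv) => nb.
  by case: (ab v).
- move=> g Pg [[_ _ h1] [_ _ h2]]; have [v Dv] := D0.
  have := DN _ Pg _ Dv; case: (pselect (inversion_set Phi Pos v g)) => Ig.
    by have [] := h2 v _; [split|tauto].
  by move=> [_ /(_ Ig) INg]; have [] := h1 v.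
- move=> g Pg [[_ _ h1] _] d Pd; split=> // v [Dv _]; split=> //.
  apply: contrapT => nIg; apply: (nIg); have [] // := h1 v.
  by split=> //; apply/(DN _ Pg _ Dv).
Qed.

(** Members of a root-triple that could pairwise be inverted by elements of [D]
    would give the three elements excluded from a Condorcet domain; these
    elements are automatically distinct, as none inverts the whole triple. *)
Lemma condorcet_domain_incompatible D a b c : condorcet_domain dot Phi Pos D ->
    root_triple Phi a b c ->
  let never x y := forall u, D u ->
    ~ (inversion_set Phi Pos u x /\ inversion_set Phi Pos u y) in
  [\/ never a b, never a c | never b c].
Proof.
move=> [DW D0 Dc] tri never; apply: contrapT => none.
have witness x y : ~ never x y -> exists u,
    D u /\ (inversion_set Phi Pos u x /\ inversion_set Phi Pos u y).
  move=> nxy; apply: contrapT => nu; apply: nxy => u Du Ixy.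
  by apply: nu; exists u.
have [u [Du [ua ub]]] := witness a b (fun h => none (Or31 _ _ h)).
have [v [Dv [va vc]]] := witness a c (fun h => none (Or32 _ _ h)).
have [w [Dw [wb wc]]] := witness b c (fun h => none (Or33 _ _ h)).
have free x : D x -> _ := fun Dx => inversion_set_triple_free (DW _ Dx) tri.
apply: Dc; exists u, v, w, a, b, c; do 2![split=> //].
by split=> e; [apply: (free u)|apply: (free v)|apply: (free u)]; rewrite ?e //;
   subst.
Qed.

(** Besides the pair provided by the previous lemma for the triple, its
    application to the negated triple gives a pair of which every element of
    [D] inverts at least one member.  The two pairs share one or two roots. *)
Lemma phi_condorcet D : condorcet_domain dot Phi Pos D ->
  condorcet_root_poset Phi (phi Phi Pos D).
Proof.
move=> Dc; have [DW D0 _] := Dc; split; first exact: phi_antipodal.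
move=> a0 b0 c0 tri; have [[Pa Pb Pc] _] := tri.
have DN a : Phi a -> forall v, D v ->
    (inversion_set Phi Pos v (- a) <-> ~ inversion_set Phi Pos v a).
  by move=> Pa' v /DW /inversion_set_half_system [_]; apply.
pose never x y := forall u, D u ->
  ~ (inversion_set Phi Pos u x /\ inversion_set Phi Pos u y).
have neverC x y : never x y -> never y x by move=> H u /H; tauto.
pose goal := exists a b c, [set a; b; c] = [set a0; b0; c0] /\
  ((phi Phi Pos D (- c) a /\ phi Phi Pos D b (- c)) \/
   preposet_eq (phi Phi Pos D) a (- c)).
have le_oppr x y : Phi x -> Phi y -> never x y -> phi Phi Pos D (- x) y.
  move=> Px Py nxy; split=> //; first exact: root_opp.
  move=> v [Dv Iy]; split=> //; apply/(DN _ Px _ Dv) => Ix.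
  exact: (nxy v).
have le_oppl x y : Phi x -> Phi y -> never (- x) (- y) -> phi Phi Pos D x (- y).
  move=> Px Py nxy; split=> //; first exact: root_opp.
  move=> v [Dv Iy]; split=> //; apply: contrapT => /(DN _ Px _ Dv) Ix.
  exact: (nxy v).
have equal x y z : Phi x -> Phi y -> [set x; y; z] = [set a0; b0; c0] ->
    never x y -> never (- x) (- y) -> goal.
  move=> Px Py xyz n1 n2; exists x, z, y; split.
    by rewrite -xyz -!setUA [[set z] `|` _]setUC.
  by right; split; [apply: le_oppl|apply: le_oppr => //; apply: neverC].
have chain x y z : Phi x -> Phi y -> Phi z ->
    [set x; y; z] = [set a0; b0; c0] ->
    never x y -> never (- x) (- z) -> goal.
  move=> Px Py Pz xyz n1 n2; exists y, z, x; split.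
    by rewrite -xyz setUC setUA.
  by left; split; [apply: le_oppr|apply: le_oppl => //; apply: neverC].
have s1 : [set a0; c0; b0] = [set a0; b0; c0] by rewrite setUAC.
have s2 : [set b0; a0; c0] = [set a0; b0; c0] by rewrite [[set b0] `|` _]setUC.
have s3 : [set b0; c0; a0] = [set a0; b0; c0] by rewrite setUAC.
have s4 : [set c0; a0; b0] = [set a0; b0; c0] by rewrite [[set c0] `|` _]setUC.
have s5 : [set c0; b0; a0] = [set a0; b0; c0] by rewrite setUAC.
case: (condorcet_domain_incompatible Dc tri) => n1;
case: (condorcet_domain_incompatible Dc (root_triple_opp tri)) => n2.
- exact: (equal a0 b0 c0).
- exact: (chain a0 b0 c0).
- by apply: (chain b0 a0 c0) => //; apply: neverC.
- exact: (chain a0 c0 b0).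
- exact: (equal a0 c0 b0).
- by apply: (chain c0 a0 b0) => //; apply: neverC.
- by apply: (chain b0 c0 a0) => //; apply: neverC.
- by apply: (chain c0 b0 a0) => //; apply: neverC.
- exact: (equal b0 c0 a0).
Qed.

Lemma symmetric_ideal_inversion_set P I : condorcet_root_poset Phi P ->
    symmetric_order_ideal Phi P I ->
  exists2 w, psi dot Phi Pos P w & inversion_set Phi Pos w = I.
Proof.
move=> Pc symI.
have [_ halfI] := (symmetric_order_idealP root_opp _ _).1 symI.
have [a b c tri [Ia Ib Ic]|w Ww wI] := half_system_inversion_set halfI.
  by case: (condorcet_triple_incompatible root_opp Pc tri) => /(_ _ symI); apply.
by exists w => //; split=> //; rewrite wI.
Qed.

Lemma psi_condorcet P : condorcet_root_poset Phi P ->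
  condorcet_domain dot Phi Pos (psi dot Phi Pos P).
Proof.
move=> Pc; split=> [w []|| ] //.
  have [||I _ symI] := isotropic_ideal_extension (J := set0)
    root_system_finite root_opp Pc.1.
  - by split=> [a []|a b []].
  - by move=> a [].
  by have [w] := symmetric_ideal_inversion_set Pc symI; exists w.
move=> [u [v [w [a [b [c [[[_ su] [_ sv] [_ sw]] [_ [tri [hu hv hw]]]]]]]]]].
case: (condorcet_triple_incompatible root_opp Pc tri) => h.
- exact: (h _ su).
- exact: (h _ sv).
- exact: (h _ sw).
Qed.

Lemma psiK P : condorcet_root_poset Phi P -> phi Phi Pos (psi dot Phi Pos P) = P.
Proof.
move=> Pc; have [Pa _] := Pc; have [[Proot _ _] _ _ _] := Pa.
apply/funext => a; apply/funext => b; apply/propext; split=> [[Ra Rb sub]|Pab].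
  apply: contrapT => nPab.
  have [I [symI Ib nIa]] :=
    separating_symmetric_ideal root_system_finite root_opp Pa Ra Rb nPab.
  have [w psiw wI] := symmetric_ideal_inversion_set Pc symI.
  by case: (sub w) => [|_]; [split; rewrite ?wI|rewrite wI].
have [Ra Rb] := Proot _ _ Pab; split=> // w [psiw Ib]; split=> //.
by case: psiw => _ [[_ down] _ _]; apply: down Pab.
Qed.

End InversionSets.

Unset Implicit Arguments.

Theorem theorem1p3 (R : realType) (V : vectType R) (dot : {dot V for idfun})
    (Phi Pos : set V) (hPhi : root_system dot Phi)
    (hPos : positive_roots dot Phi Pos) :
  let Dom : set (set 'End(V)) := [set D | condorcet_domain dot Phi Pos D] in
  let Pst : set (V -> V -> Prop) := [set P | condorcet_root_poset Phi P] in
  let ph : set 'End(V) -> V -> V -> Prop := phi Phi Pos in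
  let ps : (V -> V -> Prop) -> set 'End(V) := psi dot Phi Pos in
  [/\ (forall D, Dom D -> Pst (ph D)),
      (forall P, Pst P -> Dom (ps P)) &
      ph @` Dom = Pst] /\
  [/\ set_bij (ps @` Pst) (ph @` Dom) ph,
      set_bij (ph @` Dom) (ps @` Pst) ps,
      (forall D, (ps @` Pst) D -> ps (ph D) = D) &
      (forall P, (ph @` Dom) P -> ph (ps P) = P)].
Proof.
move=> Dom Pst ph ps; case: hPos => t [t_regular PosE].
have phP D : Dom D -> Pst (ph D).
  by rewrite /Dom /ph /= PosE; apply: phi_condorcet.
have psP P : Pst P -> Dom (ps P).
  by rewrite /Dom /ps /= PosE; apply: psi_condorcet.
have psK P : Pst P -> ph (ps P) = P.
  by rewrite /ph /ps PosE; apply: psiK.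
have phDom : ph @` Dom = Pst.
  apply/seteqP; split=> [_ [D DD <-]|P PP]; first exact: phP.
  by exists (ps P); [apply: psP|apply: psK].
have phK D : (ps @` Pst) D -> ps (ph D) = D by case=> P PP <-; rewrite psK.
rewrite phDom; do 2![split=> //]; split.
- by move=> _ [P PP <-]; rewrite psK.
- by move=> D D' /set_mem /phK {2}<- /set_mem /phK {2}<- ->.
- by move=> P PP; exists (ps P); [exists P|apply: psK].
- by move=> P PP; exists P.
- by move=> P P' /set_mem /psK {2}<- /set_mem /psK {2}<- ->.
- by move=> _ [P PP <-]; exists P.
Qed.
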